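(* Let $\alpha>-1/2$, $\lambda\geq0$ and $\nu\geq0$ be arbitrary, and let $P_n(x)=Q_n^{(\alpha,\lambda,\nu)}(x)$ $(n\in\mathbb{N}_0)$ be the associated symmetric Pollaczek polynomials, with recurrence coefficients $(c_n)_{n\in\mathbb{N}}$. Then $(c_n)_{n\in\mathbb{N}}$ is strictly increasing, and $(P_n(x))_{n\in\mathbb{N}_0}$ satisfies both (1) the nonnegative linearization property (P): for all $m,n\in\mathbb{N}_0$, all coefficients $g(m,n;k)$ in the expansion $P_m(x)P_n(x)=\sum_{k=0}^{m+n}g(m,n;k)P_k(x)$ are nonnegative; and (2) Tur\'{a}n's inequality: for all $n\in\mathbb{N}$, $$(P_n(x))^2-P_{n+1}(x)P_{n-1}(x)\geq0\quad(x\in[-1,1]),\qquad (P_n(x))^2-P_{n+1}(x)P_{n-1}(x)>0\quad(x\in(-1,1)).$$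
   Context: $\mathbb{N}=\{1,2,3,\ldots\}$, $\mathbb{N}_0=\mathbb{N}\cup\{0\}$. For $\alpha>-1/2$, $\lambda\geq0$, $\nu\geq0$, the associated Laguerre polynomials $(L_n^{(2\alpha,\nu)}(x))_{n\in\mathbb{N}_0}$ are given by $L_0^{(2\alpha,\nu)}(x)=1$, $L_1^{(2\alpha,\nu)}(x)=(-x+2\nu+2\alpha+1)/(\nu+1)$ and $$(n+\nu+1)L_{n+1}^{(2\alpha,\nu)}(x)=(-x+2n+2\nu+2\alpha+1)L_n^{(2\alpha,\nu)}(x)-(n+\nu+2\alpha)L_{n-1}^{(2\alpha,\nu)}(x)\quad(n\in\mathbb{N});$$ they are positive on $(-\infty,0]$. Put $c_0:=0$, $a_0:=1$ and, for $n\in\mathbb{N}$, $$c_n:=\frac{n+\nu+2\alpha}{2n+2\nu+2\alpha+2\lambda+1}\,\frac{L_{n-1}^{(2\alpha,\nu)}(-2\lambda)}{L_n^{(2\alpha,\nu)}(-2\lambda)}\in(0,1),\qquad a_n:=1-c_n.$$ Equivalently, $(c_n)_{n\in\mathbb{N}}$ is given by $c_0=0$ and $$c_n=\frac{1}{1-c_{n-1}}\cdot\frac{(n+\nu)(n+\nu+2\alpha)}{(2n+2\nu+2\alpha+2\lambda+1)(2n+2\nu+2\alpha+2\lambda-1)}\quad(n\in\mathbb{N}).$$ The associated symmetric Pollaczek polynomials $P_n(x)=Q_n^{(\alpha,\lambda,\nu)}(x)$ are defined by $P_0(x)=1$, $P_1(x)=x$ and $xP_n(x)=a_nP_{n+1}(x)+c_nP_{n-1}(x)$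 $(n\in\mathbb{N})$. *)

(* Defs.v *)
From mathcomp Require Import all_boot all_order all_algebra.
From mathcomp Require Import reals.

Set Implicit Arguments.
Unset Strict Implicit.
Unset Printing Implicit Defensive.

Import Order.TTheory GRing.Theory Num.Theory.
Local Open Scope ring_scope.

(* The first superscript of L_n^(2 alpha, nu) is the argument mu. The last
   branch is the three-term recurrence, with m >= 1, solved for L_(m+1). *)
Fixpoint assoc_laguerre (R : realType) (mu nu : R) (n : nat) : {poly R} :=
  match n with
  | 0 => 1
  | 1 => (nu + 1)^-1 *: (- 'X + (2 * nu + mu + 1)%:P)
  | (k.+1 as m).+1 =>
      (m%:R + nu + 1)^-1 *:
        ((- 'X + (2 * m%:R + 2 * nu + mu + 1)%:P) * assoc_laguerre mu nu m
         - (m%:R + nu + mu) *: assoc_laguerre mu nu k)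
  end.

Definition pollaczek_c (R : realType) (alpha lambda nu : R) (n : nat) : R :=
  if n is k.+1 then
    (n%:R + nu + 2 * alpha)
      / (2 * n%:R + 2 * nu + 2 * alpha + 2 * lambda + 1)
    * ((assoc_laguerre (2 * alpha) nu k).[- 2 * lambda]
       / (assoc_laguerre (2 * alpha) nu n).[- 2 * lambda])
  else 0.

Definition pollaczek_a (R : realType) (alpha lambda nu : R) (n : nat) : R :=
  1 - pollaczek_c alpha lambda nu n.

(* The last branch is x P_m = a_m P_(m+1) + c_m P_(m-1), with m >= 1, solved
   for P_(m+1). *)
Fixpoint assoc_pollaczek (R : realType) (alpha lambda nu : R) (n : nat) :
    {poly R} :=
  match n with
  | 0 => 1
  | 1 => 'X
  | (k.+1 as m).+1 =>
      (pollaczek_a alpha lambda nu m)^-1 *: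
        ('X * assoc_pollaczek alpha lambda nu m
         - pollaczek_c alpha lambda nu m *: assoc_pollaczek alpha lambda nu k)
  end.

Definition linearization (R : realType) (P : nat -> {poly R}) (m n : nat)
    (g : 'I_(m + n).+1 -> R) : Prop :=
  P m * P n = \sum_(k < (m + n).+1) g k *: P k.

(* The existence clause keeps the property from holding vacuously when P_m P_n
   has no expansion in P_0, ..., P_(m+n). *)
Definition nonneg_linearization (R : realType) (P : nat -> {poly R}) : Prop :=
  forall m n : nat,
    (exists g : 'I_(m + n).+1 -> R, linearization P g) /\
    (forall g : 'I_(m + n).+1 -> R, linearization P g -> forall k, 0 <= g k).

Definition turan_det (R : realType) (P : nat -> {poly R}) (n : nat) (x : R) : R :=
  (P n).[x] ^+ 2 - (P n.+1).[x] * (P n.-1).[x].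

(* Main.v *)
Require Import Defs.
From mathcomp Require Import all_boot all_order all_algebra.
From mathcomp Require Import reals ring lra zify.

Set Implicit Arguments.
Unset Strict Implicit.
Unset Printing Implicit Defensive.

Import Order.TTheory GRing.Theory Num.Theory.
Local Open Scope ring_scope.

(** Both the linearization property and Turan's inequality follow from three
    facts about the recurrence coefficients alone: [c] is increasing,
    [0 = c 0 < c n], and [c n < 1 / 2].

    Put [N = n + nu], write [L_n] for the associated Laguerre value at
    [- 2 lambda] and [s_n = 2 N + 2 alpha + 2 lambda + 1].  The ratio
    [f_n = (N + 2 alpha) L_(n-1) / (N L_n)] satisfies [c_n = (N / s_n) f_n] and
    the Riccati-type recurrence [f_(n+1) (s_n - N f_n) = N + 1 + 2 alpha].
    The factor [N / s_n] is strictly increasing with values below [1 / 2],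
    because [2 alpha + 2 lambda + 1 > 0].  The Laguerre recurrence gives
    [f <= 1]; and [f] is nondecreasing, since if [f_n <= f_(n+1) = y] then
    [y (s_(n+1) - (N + 1) y) = y (s_n - N y) + 2 y - y ^ 2
     <= N + 1 + 2 alpha + 1 - (1 - y) ^ 2], which is at most the value
    [N + 2 + 2 alpha] that [f_(n+2)] gives in place of [y]
    ([laguerre_ratio_mono]).  Estimating the chain sequence
    [c_n (1 - c_(n-1))] directly would be harder, because it need not be
    monotone in [n].

    Turan determinants [D_n] obey
    [(1 - c_n) D_n = c_(n-1) D_(n-1) + (c_n - c_(n-1)) (P_(n-1)^2 - P_n^2)]
    ([turan_detS]), which carries positivity along when
    [|P_n| <= |P_(n-1)|].  In the opposite case [(1 - c_n) D_n], as a quadratic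
    form in [P_n] and [P_(n-1)], is bounded below by
    [(|P_n| - |P_(n-1)|) ((1 - c_n) |P_n| - c_n |P_(n-1)|) > 0].

    For linearization, rescale to [p_n = w_n P_n] with [w_n > 0] so that the two
    coefficients of the recurrence trade places:
    [x p_n = c_(n+1) p_(n+1) + (1 - c_(n-1)) p_(n-1)].  Summing the discrete wave
    equation for the array [p_n p_m] over the backward light cone of a point,
    all interior contributions cancel, because the two coefficients at each
    index add up to [1].  What is left ([dual_product]) expresses
    [c_m p_n p_m] through products [p_i p_j] with [j < m] and [j <= i], whose
    coefficients [c_i - c_j] and [1 - c_i - c_j] are nonnegative; induction on
    [m] concludes.  The idea of a discrete boundary value problem is due to
    Szwarc. *)

(** * Recurrence coefficients as Laguerre ratios *)

Section LaguerreRatios.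
Variables (R : realType) (alpha lambda nu : R).

Definition laguerre_val (n : nat) : R :=
  (assoc_laguerre (2 * alpha) nu n).[- 2 * lambda].

Definition pollaczek_den (n : nat) : R :=
  2 * n%:R + 2 * nu + 2 * alpha + 2 * lambda + 1.

Definition laguerre_ratio (n : nat) : R :=
  (n.+1%:R + nu + 2 * alpha) * laguerre_val n
    / ((n.+1%:R + nu) * laguerre_val n.+1).

Local Notation l := laguerre_val.
Local Notation s := pollaczek_den.
Local Notation f := laguerre_ratio.
Local Notation c := (pollaczek_c alpha lambda nu).

Hypotheses (halpha : - (1 / 2) < alpha) (hlambda : 0 <= lambda) (hnu : 0 <= nu).

Local Ltac param_lra := have ? := halpha; have ? := hlambda; have ? := hnu; lra.
Local Ltac param_nra := have ? := halpha; have ? := hlambda; have ? := hnu; nra.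

Lemma laguerre_val0 : l 0 = 1.
Proof. by rewrite /l /= hornerC. Qed.

Lemma laguerre_val1 : (1 + nu) * l 1 = s 0.
Proof.
rewrite /l /s /= hornerZ hornerD hornerN hornerX hornerC.
by field; rewrite lt0r_neq0 //; param_lra.
Qed.

Lemma laguerre_val_rec k :
  (k.+2%:R + nu) * l k.+2 = s k.+1 * l k.+1 - (k.+1%:R + nu + 2 * alpha) * l k.
Proof.
have k0 : 0 <= k%:R :> R by [].
have -> : l k.+2 = (k.+1%:R + nu + 1)^-1 *
    ((2 * lambda + (2 * k.+1%:R + 2 * nu + 2 * alpha + 1)) * l k.+1
     - (k.+1%:R + nu + 2 * alpha) * l k).
  rewrite {1}/laguerre_val [assoc_laguerre _ _ k.+2]/=.
  rewrite -[match k with 0 => _ | _ => _ end]/(assoc_laguerre (2 * alpha) nu k.+1).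
  rewrite hornerZ hornerD hornerN hornerM hornerD hornerN hornerX hornerC hornerZ.
  by rewrite /laguerre_val mulNr opprK.
by rewrite /s -!natr1; field; rewrite lt0r_neq0 //; param_lra.
Qed.

(** The difference of the two sides of the inequality grows by
    [2 lambda L_(k+1)] at each step, so it stays nonnegative as long as the
    values stay positive; conversely it forces the next value to be
    positive. *)
Lemma laguerre_val_gt0_le k :
  0 < l k /\ (k.+1%:R + nu + 2 * alpha) * l k <= (k.+1%:R + nu) * l k.+1.
Proof.
elim: k => [|k [lk le_l]].
  by rewrite laguerre_val1 laguerre_val0 /s; split; param_lra.
have k0 : 0 <= k%:R :> R by [].
rewrite -natr1 in le_l.
have lk1 : 0 < l k.+1.
  have : 0 < (k%:R + 1 + nu) * l k.+1.
    by apply: lt_le_trans le_l; apply: mulr_gt0 => //; param_lra.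
  by rewrite pmulr_rgt0 //; param_lra.
split=> //; rewrite laguerre_val_rec /s -!natr1.
have : 0 <= lambda * l k.+1 by apply: mulr_ge0 => //; exact: ltW.
by param_lra.
Qed.

Lemma laguerre_val_gt0 n : 0 < l n.
Proof. by case: (laguerre_val_gt0_le n). Qed.

Lemma pollaczek_den_gt0 n : 0 < s n.
Proof. by have n0 : 0 <= n%:R :> R by []; rewrite /s; param_lra. Qed.

Lemma laguerre_ratio_gt0 k : 0 < f k.
Proof.
have k0 : 0 <= k%:R :> R by [].
by rewrite /f -natr1 divr_gt0 // mulr_gt0 ?laguerre_val_gt0 //; param_lra.
Qed.

Lemma laguerre_ratio_le1 k : f k <= 1.
Proof.
have k0 : 0 <= k%:R :> R by [].
rewrite /f ler_pdivrMr; first by rewrite mul1r; case: (laguerre_val_gt0_le k).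
by rewrite mulr_gt0 ?laguerre_val_gt0 // -natr1; param_lra.
Qed.

Lemma laguerre_ratio0 : f 0 * s 0 = 1 + nu + 2 * alpha.
Proof.
rewrite /f laguerre_val1 laguerre_val0 mulr1 divfK //.
by rewrite lt0r_neq0 ?pollaczek_den_gt0.
Qed.

Lemma pollaczek_den_sub_ratio k :
  s k.+1 - (k.+1%:R + nu) * f k = (k.+2%:R + nu) * l k.+2 / l k.+1.
Proof.
have k0 : 0 <= k%:R :> R by [].
have l1 := laguerre_val_gt0 k.+1.
rewrite laguerre_val_rec /f -!natr1.
by field; rewrite !lt0r_neq0 //; param_lra.
Qed.

Lemma laguerre_ratio_rec k :
  f k.+1 * (s k.+1 - (k.+1%:R + nu) * f k) = k.+2%:R + nu + 2 * alpha.
Proof.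
have k0 : 0 <= k%:R :> R by [].
have l1 := laguerre_val_gt0 k.+1; have l2 := laguerre_val_gt0 k.+2.
rewrite pollaczek_den_sub_ratio /f -!natr1.
by field; rewrite !lt0r_neq0 //; param_lra.
Qed.

(** The map sending [f_k] to [f_(k+1)] depends on [k], so monotonicity is not a
    formal consequence of one comparison; it holds because replacing [k] by
    [k + 1] changes [y (s - N y)] by [2 y - y ^ 2 <= 1], exactly the increment
    of the right-hand side of the recurrence. *)
Lemma laguerre_ratio_mono k : f k <= f k.+1.
Proof.
have den0 j : 0 < s j.+1 - (j.+1%:R + nu) * f j.
  have j0 : 0 <= j%:R :> R by [].
  rewrite pollaczek_den_sub_ratio divr_gt0 ?mulr_gt0 ?laguerre_val_gt0 //.
  by rewrite -!natr1; param_lra.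
rewrite -(ler_pM2r (den0 k)) laguerre_ratio_rec.
elim: k => [|k IH].
  have -> : s 1 = s 0 + 2 by rewrite /s; ring.
  (* The recurrence starts as if a ratio equal to 0 preceded f 0; what is lost
     is nu * f 0 ^+ 2. *)
  have := laguerre_ratio0.
  have := mulr_ge0 hnu (sqr_ge0 (f 0)).
  have := sqr_ge0 (1 - f 0).
  by param_nra.
have k0 : 0 <= k%:R :> R by [].
have le_f : f k <= f k.+1.
  by rewrite -(ler_pM2r (den0 k)) laguerre_ratio_rec.
have := laguerre_ratio_rec k.
have -> : s k.+2 = s k.+1 + 2 by rewrite /s -!natr1; ring.
have : 0 <= (k.+1%:R + nu) * (f k.+1 * (f k.+1 - f k)).
  have ? : 0 <= k.+1%:R + nu by rewrite -natr1; param_lra.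
  have ? := ltW (laguerre_ratio_gt0 k.+1).
  by do 2?[apply: mulr_ge0 => //]; rewrite subr_ge0.
have := sqr_ge0 (1 - f k.+1).
by rewrite -!natr1; param_lra.
Qed.

Lemma pollaczek_cE k : c k.+1 = (k.+1%:R + nu) / s k.+1 * f k.
Proof.
have k0 : 0 <= k%:R :> R by [].
have l1 := laguerre_val_gt0 k.+1; have s1 := pollaczek_den_gt0 k.+1.
rewrite /pollaczek_c -/(l k) -/(l k.+1) -/(s k.+1) /f -!natr1.
by field; rewrite !lt0r_neq0 //; param_lra.
Qed.

Lemma pollaczek_c_gt0 k : 0 < c k.+1.
Proof.
have k0 : 0 <= k%:R :> R by [].
rewrite pollaczek_cE mulr_gt0 ?laguerre_ratio_gt0 // divr_gt0 ?pollaczek_den_gt0 //.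
by rewrite -natr1; param_lra.
Qed.

Lemma pollaczek_c_lt_half n : c n < 1 / 2.
Proof.
case: n => [|k]; first by rewrite /=; param_lra.
have k0 : 0 <= k%:R :> R by [].
rewrite pollaczek_cE mulrAC ltr_pdivrMr ?pollaczek_den_gt0 //.
apply: (@le_lt_trans _ _ (k.+1%:R + nu)).
  by rewrite ler_piMr ?laguerre_ratio_le1 // -natr1; param_lra.
by rewrite /s -natr1; param_lra.
Qed.

Lemma pollaczek_c_ltS k : c k.+1 < c k.+2.
Proof.
have k0 : 0 <= k%:R :> R by [].
have [s1 s2] := (pollaczek_den_gt0 k.+1, pollaczek_den_gt0 k.+2).
rewrite !pollaczek_cE.
(* Both factors increase, the first one strictly. *)
apply: (@lt_le_trans _ _ ((k.+2%:R + nu) / s k.+2 * f k)).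
  rewrite ltr_pM2r ?laguerre_ratio_gt0 // ltr_pdivrMr // mulrAC ltr_pdivlMr //.
  by rewrite /s -!natr1; param_nra.
rewrite ler_pM2l ?laguerre_ratio_mono // divr_gt0 //.
by rewrite -!natr1; param_lra.
Qed.

End LaguerreRatios.

(** * Turan determinants *)

(** The form dominates [(|y| - |z|) (a |y| - c |z|)], since [x y z] is at most
    [(a + c) |y| |z|]. *)
Lemma turan_form_gt0 (R : realDomainType) (a c x y z : R) :
  0 <= c -> c < a -> a + c = 1 -> `|x| <= 1 -> `|z| < `|y| ->
  0 < a * y ^+ 2 + c * z ^+ 2 - x * y * z.
Proof.
move=> c0 ca ac1 x1 zy.
have z0 := normr_ge0 z.
apply: (@lt_le_trans _ _ ((`|y| - `|z|) * (a * `|y| - c * `|z|))).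
  by apply: mulr_gt0; nra.
rewrite -(real_normK (num_real y)) -(real_normK (num_real z)).
have : x * y * z <= `|y| * `|z|.
  apply: le_trans (ler_norm _) _; rewrite !normrM -mulrA.
  by rewrite ler_piMl // mulr_ge0.
by rewrite !expr2; nra.
Qed.

Section RandomWalkPolynomials.
Variables (R : realType) (c : nat -> R) (P : nat -> {poly R}).

(** At [n = 0] the predecessor is truncated, which does no harm when
    [c 0 = 0]: the relation then reads [P 1 = 'X]. *)
Definition random_walk_poly : Prop :=
  P 0 = 1 /\ forall n, 'X * P n = (1 - c n) *: P n.+1 + c n *: P n.-1.

(** Eliminate [P_(n+3)] on the left and [P_n] on the right: both sides become
    quadratic forms in the same two neighbours with the same cross term, so
    only the change of the diagonal coefficients survives. *)
Lemma turan_detS n x : random_walk_poly -> (1 - c n.+2) * turan_det P n.+2 x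
  = c n.+1 * turan_det P n.+1 x
    + (c n.+2 - c n.+1) * ((P n.+1).[x] ^+ 2 - (P n.+2).[x] ^+ 2).
Proof.
case=> _ recP; rewrite /turan_det /=.
have := congr1 (horner^~ x) (recP n.+1); have := congr1 (horner^~ x) (recP n.+2).
rewrite /= !(hornerD, hornerM, hornerZ, hornerX) => e2 e1.
have := congr1 ( *%R (P n.+2).[x]) e1; have := congr1 ( *%R (P n.+1).[x]) e2.
by lra.
Qed.

Lemma turan_det_form n x : random_walk_poly -> (1 - c n.+1) * turan_det P n.+1 x
  = (1 - c n.+1) * (P n.+1).[x] ^+ 2 + c n.+1 * (P n).[x] ^+ 2
    - x * (P n.+1).[x] * (P n).[x].
Proof.
case=> _ recP; rewrite /turan_det /=.
have := congr1 (horner^~ x) (recP n.+1).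
rewrite /= !(hornerD, hornerM, hornerZ, hornerX) => e1.
have := congr1 ( *%R (P n).[x]) e1.
by lra.
Qed.


Lemma turan_det1 x : random_walk_poly -> c 0 = 0 ->
  (1 - c 1) * turan_det P 1 x = c 1 * (1 - x ^+ 2).
Proof.
move=> rwP c0; rewrite turan_det_form //; case: (rwP) => P0 recP.
have -> : P 1 = 'X.
  by have := recP 0; rewrite c0 P0 subr0 scale0r scale1r mulr1 addr0.
by rewrite P0 hornerX hornerC; ring.
Qed.

Lemma turan_det_sign : random_walk_poly -> c 0 = 0 ->
  (forall n, 0 < c n.+1) -> (forall n, c n < 1 / 2) ->
  (forall n, c n.+1 <= c n.+2) -> forall n x,
  (-1 <= x <= 1 -> 0 <= turan_det P n.+1 x) /\
  (-1 < x < 1 -> 0 < turan_det P n.+1 x).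
Proof.
move=> rwP c0 c_gt0 c_lt c_le n x.
have a_gt0 k : 0 < 1 - c k by have := c_lt k; lra.
elim: n => [|n [IHle IHlt]].
  rewrite -(pmulr_rge0 _ (a_gt0 1)) -(pmulr_rgt0 _ (a_gt0 1)) turan_det1 //.
  by rewrite pmulr_rge0 // pmulr_rgt0 //; split; nra.
rewrite -(pmulr_rge0 _ (a_gt0 n.+2)) -(pmulr_rgt0 _ (a_gt0 n.+2)).
(* The inductive identity is useful only when |P_n| does not increase;
   otherwise the quadratic form is positive by itself. *)
have [ltP|leP] := ltP `|(P n.+1).[x]| `|(P n.+2).[x]|.
  have pos : -1 <= x <= 1 -> 0 < (1 - c n.+2) * turan_det P n.+2 x.
    move=> x1; rewrite turan_det_form //; apply: turan_form_gt0 => //.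
    - exact: ltW.
    - by have := c_lt n.+2; lra.
    - by ring.
    - by rewrite ler_norml.
  by split=> x1; [apply: ltW|]; apply: pos; lra.
rewrite turan_detS //.
have ge0 : 0 <= (c n.+2 - c n.+1) * ((P n.+1).[x] ^+ 2 - (P n.+2).[x] ^+ 2).
  apply: mulr_ge0; rewrite subr_ge0 //.
  rewrite -(real_normK (num_real (P n.+1).[x])) -(real_normK (num_real (P n.+2).[x])) ler_pXn2r ?nnegrE //.
split=> x1.
  by rewrite addr_ge0 // mulr_ge0 ?IHle // ltW.
by rewrite ltr_wpDr // mulr_gt0 // IHlt.
Qed.

End RandomWalkPolynomials.

(** * Product formula for the dual recurrence *)

Section DualProduct.
Variables (A : comNzRingType) (c p : nat -> A) (x : A).

(** With [n = m + d], this is the solution of a boundary value problem for the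
    array [u (n, m) = p_n p_m], which satisfies a discrete wave equation
    because multiplication by [x] may be carried out in either factor.  The
    sums run over the two edges of the backward light cone issued from
    [(n, m)].  An algebraic proof by two-step induction on [m]: the edge sums
    at [(n, m + 2)] regroup into those at [(n + 1, m + 1)], [(n - 1, m + 1)]
    and [(n, m)]. *)
Lemma dual_product :
  c 0 = 0 -> x * p 0 = c 1 * p 1 ->
  (forall n, x * p n.+1 = c n.+2 * p n.+2 + (1 - c n) * p n) ->
  p 0 = 1 ->
  forall m d, c m * p (m + d)%N * p m
    = \sum_(j < m) (c (m + d + m - j)%N - c j) * p (m + d + m - j)%N * p j
      + \sum_(j < m) (1 - c (d + j)%N - c j) * p (d + j)%N * p j.
Proof.
move=> c0 rec0 recp p0.
set U := fun m e => \sum_(j < m) (c (e - j)%N - c j) * p (e - j)%N * p j.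
set V := fun m d => \sum_(j < m) (1 - c (d + j)%N - c j) * p (d + j)%N * p j.
have US m e : U m.+1 e = U m e + (c (e - m)%N - c m) * p (e - m)%N * p m.
  by rewrite /U big_ord_recr.
have VS m d : V m.+1 d = V m d + (1 - c (d + m)%N - c m) * p (d + m)%N * p m.
  by rewrite /V big_ord_recr.
have U0 e : U 0 e = 0 by rewrite /U big_ord0.
have V0 d : V 0 d = 0 by rewrite /V big_ord0.
move=> m d; rewrite -/(U m (m + d + m)%N) -/(V m d).
suff H k : (forall d, c k * p (k + d)%N * p k = U k (k + d + k)%N + V k d) /\
  (forall d, c k.+1 * p (k.+1 + d)%N * p k.+1
     = U k.+1 (k.+1 + d + k.+1)%N + V k.+1 d) by case: (H m).
elim: k => [|k [IH0 IH1]].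
  split=> e; first by rewrite c0 !mul0r U0 V0 addr0.
  rewrite US VS U0 V0 c0 p0 !add0r subn0 addn0 !subr0 !mulr1.
  rewrite mulrAC -rec0 p0 mulr1 add1n recp.
  by rewrite (_ : (e.+1 + 1)%N = e.+2) //; lia.
split=> // e.
have := IH1 e; have := IH1 e.+2; have := IH0 e.+2.
rewrite !(US k.+1) !(VS k.+1) !(VS k e.+2) (US k (k.+1 + e + k.+1)%N).
have -> : (k.+2 + e + k.+2 - k.+1 = k + e.+3)%N by lia.
have -> : (k.+2 + e + k.+2 = k.+1 + e.+2 + k.+1)%N by lia.
have -> : (k.+1 + e + k.+1 - k = k + e.+2)%N by lia.
have -> : (k.+1 + e + k.+1 = k + e.+2 + k)%N by lia.
have -> : (k.+2 + e = k + e.+2)%N by lia.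
have -> : (k.+1 + e.+2 = k + e.+3)%N by lia.
have -> : (k.+1 + e = k + e.+1)%N by lia.
have -> : (e.+2 + k = k + e.+2)%N by lia.
have -> : (e + k.+1 = k + e.+1)%N by lia.
have := recp (k + e.+1)%N; have := recp k.
rewrite !addnS => r1 r2 h0 h1 h2.
have e1 : c k.+2 * p k.+2 = x * p k.+1 - (1 - c k) * p k by rewrite r1 addrK.
rewrite mulrAC e1.
have -> : (x * p k.+1 - (1 - c k) * p k) * p (k + e).+2
    = p k.+1 * (x * p (k + e).+2) - (1 - c k) * p k * p (k + e).+2 by ring.
rewrite r2; move/esym/(canRL (addrK _)): h1 => ->.
move/esym/(canRL (addKr _)): h2 => ->.
move/esym/(canRL (addrK _)): h0 => ->.
by ring.
Qed.
End DualProduct.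

(** * Nonnegative combinations and uniqueness of expansions *)

Section NonnegativeCombinations.
Variables (R : realType) (P : nat -> {poly R}).

Definition nonneg_comb (N : nat) (q : {poly R}) : Prop :=
  exists2 g : nat -> R, forall k, 0 <= g k & q = \sum_(k < N) g k *: P k.

Lemma nonneg_comb0 N : nonneg_comb N 0.
Proof.
exists (fun=> 0) => //; rewrite big1 // => k _.
by rewrite scale0r.
Qed.

Lemma nonneg_combD N q r :
  nonneg_comb N q -> nonneg_comb N r -> nonneg_comb N (q + r).
Proof.
move=> [g g0 ->] [h h0 ->]; exists (fun k => g k + h k).
  by move=> k; rewrite addr_ge0.
by rewrite -big_split; apply: eq_bigr => k _; rewrite scalerDl.
Qed.

Lemma nonneg_combZ N b q : 0 <= b -> nonneg_comb N q -> nonneg_comb N (b *: q).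
Proof.
move=> b0 [g g0 ->]; exists (fun k => b * g k).
  by move=> k; rewrite mulr_ge0.
by rewrite scaler_sumr; apply: eq_bigr => k _; rewrite scalerA.
Qed.

Lemma nonneg_comb_sum N n (F : 'I_n -> {poly R}) :
  (forall j, nonneg_comb N (F j)) -> nonneg_comb N (\sum_(j < n) F j).
Proof.
move=> HF; elim/big_ind: _ => //; first exact: nonneg_comb0.
exact: nonneg_combD.
Qed.

Lemma nonneg_comb_widen M N q : (M <= N)%N -> nonneg_comb M q -> nonneg_comb N q.
Proof.
move=> leMN [g g0 ->]; exists (fun k => if (k < M)%N then g k else 0).
  by move=> k; case: ifP.
rewrite (big_ord_widen N (fun k => g k *: P k)) // big_mkcond.
by apply: eq_bigr => k _; case: ifP => // _; rewrite scale0r.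
Qed.

Lemma nonneg_comb_basis n : nonneg_comb n.+1 (P n).
Proof.
exists (fun k => (k == n)%:R) => //.
rewrite big_ord_recr /= eqxx scale1r big1 ?add0r // => k _.
by rewrite ltn_eqF // scale0r.
Qed.

Lemma graded_family_free N (d : 'I_N -> R) :
  (forall n, size (P n) = n.+1) -> \sum_(k < N) d k *: P k = 0 -> forall k, d k = 0.
Proof.
move=> sizeP; elim: N d => [d _ [] //|N IH d].
rewrite big_ord_recr /= => sum0.
have dmax : d ord_max = 0.
  have := congr1 (fun q : {poly R} => q`_N) sum0.
  rewrite coefD coefZ coef0 coef_sum big1 => [|k _].
    rewrite add0r => /eqP; rewrite mulf_eq0 => /orP[/eqP //|/eqP lead0].
    have : lead_coef (P N) = 0 by rewrite lead_coefE sizeP.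
    by move/eqP; rewrite lead_coef_eq0 -size_poly_eq0 sizeP.
  by rewrite coefZ nth_default ?mulr0 // sizeP.
move: sum0; rewrite dmax scale0r addr0 => /(IH (fun k => d (widen_ord (leqnSn N) k))) d0 k.
case: (unliftP ord_max k) => [j ->|-> //].
by rewrite -(d0 j); congr (d _); apply: val_inj; exact: lift_max.
Qed.

Lemma graded_nonneg_linearization : (forall n, size (P n) = n.+1) ->
  (forall m n, nonneg_comb (m + n).+1 (P m * P n)) -> nonneg_linearization P.
Proof.
move=> sizeP HP m n; have [h h0 Eh] := HP m n.
split; first by exists (fun k => h k).
move=> g Eg k; suff -> : g k = h k by [].
apply/eqP; rewrite -subr_eq0; apply/eqP.
pose d (j : 'I_(m + n).+1) := g j - h j.
apply: (graded_family_free (d := d) sizeP); rewrite /d.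
under eq_bigr => j _ do rewrite scalerBl.
by rewrite sumrB -Eg -Eh subrr.
Qed.

End NonnegativeCombinations.

(** * Nonnegative linearization *)

Section Linearization.
Variables (R : realType) (c : nat -> R) (P : nat -> {poly R}).

Lemma random_walk_poly_size : random_walk_poly c P ->
  c 0 = 0 -> (forall n, c n < 1 / 2) -> forall n, size (P n) = n.+1.
Proof.
move=> [P0 recP] c0 c_lt.
have a_neq0 n : 1 - c n != 0 by rewrite lt0r_neq0 //; have := c_lt n; lra.
have size_rec n : size (P n) = n.+1 -> (size (P n.-1) <= n.+1)%N -> size (P n.+1) = n.+2.
  move=> sn sm; rewrite -(size_scale _ (a_neq0 n)).
  have -> : (1 - c n) *: P n.+1 = 'X * P n - c n *: P n.-1 by rewrite recP addrK.
  have Pn0 : P n != 0 by rewrite -size_poly_eq0 sn.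
  rewrite size_polyDl mulrC size_mulX ?sn // size_polyN.
  by rewrite (leq_ltn_trans (size_scale_leq _ _)) // ltnS.
move=> n; suff [] : size (P n) = n.+1 /\ size (P n.+1) = n.+2 by [].
elim: n => [|n [sn sSn]].
  have s0 : size (P 0) = 1 by rewrite P0 size_poly1.
  by split=> //; apply: size_rec; rewrite ?s0.
by split=> //; apply: size_rec; rewrite // sn; lia.
Qed.

(** The weight that turns the coefficients [(1 - c n, c n)] of the recurrence
    into [(c n.+1, 1 - c n.-1)]; see [dual_weightS]. *)
Definition dual_weight (n : nat) : R := \prod_(k < n) ((1 - c k) / c k.+1).

Lemma dual_weight_gt0 n : (forall k, 0 < c k.+1) -> (forall k, c k < 1 / 2) ->
  0 < dual_weight n.
Proof.
move=> c_gt0 c_lt; apply: prodr_gt0 => k _; apply: divr_gt0 => //.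
by have := c_lt k; lra.
Qed.

Lemma dual_weightS n : (forall k, 0 < c k.+1) ->
  c n.+1 * dual_weight n.+1 = (1 - c n) * dual_weight n.
Proof.
move=> c_gt0; rewrite /dual_weight big_ord_recr /=.
by field; rewrite lt0r_neq0.
Qed.

Local Notation p := (fun n => dual_weight n *: P n).

(** Each product on the right of [dual_product] has a smaller second index not
    exceeding the first, so strong induction on [m] applies. *)
Lemma dual_nonneg_product : random_walk_poly c P ->
  c 0 = 0 -> (forall n, 0 < c n.+1) -> (forall n, c n < 1 / 2) ->
  {homo c : m n / (m <= n)%N >-> m <= n} ->
  forall m d, nonneg_comb P (m + (m + d)).+1 (p (m + d)%N * p m).
Proof.
move=> [P0 recP] c0 c_gt0 c_lt c_mono.
have w0 : dual_weight 0 = 1 by rewrite /dual_weight big_ord0.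
have p0 : p 0 = 1 by rewrite /= w0 scale1r P0.
have rec0 : 'X * p 0 = (c 1)%:P * p 1.
  by rewrite /= -scalerAr recP c0 scale0r addr0 mul_polyC !scalerA dual_weightS // c0 mulrC.
have recp n : 'X * p n.+1 = (c n.+2)%:P * p n.+2 + (1 - (c n)%:P) * p n.
  rewrite /= -scalerAr recP -polyC1 -polyCB !mul_polyC scalerDr !scalerA.
  by rewrite dual_weightS // -(dual_weightS n) //= mulrC [_ * c n.+1]mulrC.
move=> m; elim/ltn_ind: m => -[_ d|m IH d].
  rewrite /= w0 scale1r P0 mulr1; apply: nonneg_combZ; last exact: nonneg_comb_basis.
  exact: ltW (dual_weight_gt0 _ _ _).
have c00 : (c 0)%:P = 0 by rewrite c0 polyC0.
have := @dual_product _ (fun n => (c n)%:P) p 'X c00 rec0 recp p0 m.+1 d.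
rewrite -mulrA mul_polyC => /(congr1 ( *:%R (c m.+1)^-1)).
rewrite scalerA mulVf ?lt0r_neq0 // scale1r => ->.
apply: nonneg_combZ; first by rewrite invr_ge0 ltW.
apply: nonneg_combD; apply: nonneg_comb_sum => j.
  have lt_j := ltn_ord j.
  rewrite -polyCB -mulrA mul_polyC.
  apply: nonneg_combZ; first by rewrite subr_ge0 c_mono //; lia.
  have := IH j lt_j (m.+1 + d + m.+1 - j - j)%N.
  rewrite (_ : (j + (m.+1 + d + m.+1 - j - j) = m.+1 + d + m.+1 - j)%N); last by lia.
  by apply: nonneg_comb_widen; lia.
have lt_j := ltn_ord j.
rewrite -polyC1 -!polyCB -mulrA mul_polyC.
apply: nonneg_combZ; first by have := c_lt (d + j)%N; have := c_lt j; lra.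
have := IH j lt_j d; rewrite [(j + d)%N]addnC.
by apply: nonneg_comb_widen; lia.
Qed.

(** Positive rescaling of a basis does not affect signs of coefficients, so the
    statement for the dual normalization carries over. *)
Lemma random_walk_nonneg_linearization : random_walk_poly c P ->
  c 0 = 0 -> (forall n, 0 < c n.+1) -> (forall n, c n < 1 / 2) ->
  {homo c : m n / (m <= n)%N >-> m <= n} ->
  nonneg_linearization P.
Proof.
move=> rwP c0 c_gt0 c_lt c_mono; apply: graded_nonneg_linearization.
  exact: random_walk_poly_size.
have H m n : (m <= n)%N -> nonneg_comb P (m + n).+1 (P n * P m).
  move=> /subnKC <-; set d := (n - m)%N.
  have wm := dual_weight_gt0 m c_gt0 c_lt.
  have wn := dual_weight_gt0 (m + d) c_gt0 c_lt.
  have := dual_nonneg_product rwP c0 c_gt0 c_lt c_mono m d.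
  rewrite /= -scalerAl -scalerAr scalerA.
  have w_gt0 := mulr_gt0 wn wm.
  have winv_ge0 := ltW (etrans (invr_gt0 _) w_gt0).
  move/(nonneg_combZ winv_ge0).
  by rewrite scalerA mulVf ?scale1r // lt0r_neq0.
move=> m n; have [/H|/ltnW/H] := leqP m n; first by rewrite mulrC.
by rewrite addnC.
Qed.

End Linearization.


(** * Associated symmetric Pollaczek polynomials *)

Lemma assoc_pollaczek_random_walk (R : realType) (alpha lambda nu : R) :
  - (1 / 2) < alpha -> 0 <= lambda -> 0 <= nu ->
  random_walk_poly (pollaczek_c alpha lambda nu) (assoc_pollaczek alpha lambda nu).
Proof.
move=> halpha hlambda hnu; split=> // -[|k].
  by rewrite /= subr0 scale0r addr0 scale1r mulr1.
have a_neq0 : 1 - pollaczek_c alpha lambda nu k.+1 != 0.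
  by rewrite lt0r_neq0 //; have := pollaczek_c_lt_half halpha hlambda hnu k.+1; lra.
rewrite [assoc_pollaczek _ _ _ k.+2]/= scalerA /pollaczek_a divff // scale1r.
by rewrite subrK.
Qed.

Theorem theorem4p1 (R : realType) (alpha lambda nu : R)
    (halpha : - (1 / 2) < alpha) (hlambda : 0 <= lambda) (hnu : 0 <= nu) :
  let c := pollaczek_c alpha lambda nu in
  let P := assoc_pollaczek alpha lambda nu in
  (forall m n : nat, (0 < m)%N -> (m < n)%N -> c m < c n) /\
  nonneg_linearization P /\
  (forall n : nat, (0 < n)%N ->
     (forall x : R, -1 <= x <= 1 -> 0 <= turan_det P n x) /\
     (forall x : R, -1 < x < 1 -> 0 < turan_det P n x)).
Proof.
move=> c P.
have c0 : c 0 = 0 by [].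
have c_gt0 n : 0 < c n.+1 by apply: pollaczek_c_gt0.
have c_lt n : c n < 1 / 2 by apply: pollaczek_c_lt_half.
have c_ltS n : c n.+1 < c n.+2 by apply: pollaczek_c_ltS.
have rwP : random_walk_poly c P by apply: assoc_pollaczek_random_walk.
split=> [[//|m] [//|n] _|].
  rewrite ltnS; move: m n.
  exact: (@homo_ltn _ (fun n => c n.+1) _ lt_trans).
split.
  apply: (random_walk_nonneg_linearization rwP) => //.
  apply: homo_leq => //; first exact: le_trans.
  by case=> [|n]; rewrite ?c0 ltW.
by case=> // n _; split=> x;
  have [] := turan_det_sign rwP c0 c_gt0 c_lt (fun n => ltW (c_ltS n)) n x.
Qed.
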